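(* Let $\Bbbk$ be a field, and let $\mathcal{C}$ be a Cauchy complete $\Bbbk$-linear braided monoidal category with finite dimensional morphism spaces and $\operatorname{End}(\mathbf{1})=\Bbbk$. Let $X\in\mathcal{C}$ be a non-negligible (indecomposable) object of moderate growth. Then $X$ is rigid.
   Context: A linear category is Cauchy complete if it admits (finite) direct sums and is idempotent (Karoubi) complete. $\mathbf{1}$ denotes the monoidal unit. An indecomposable object $X\in\mathcal{C}$ is non-negligible if there exists $Y\in\mathcal{C}$ such that $\mathbf{1}$ is a direct summand of $Y\otimes X$. An object $X$ has moderate growth if there exists $n\in\mathbb{N}$ such that $\dim_{\Bbbk}\operatorname{End}(X^{\otimes n})<n!$. An object is rigid if it admits a left dual and a right dual (with evaluation and coevaluation morphisms satisfying the zig-zag identities). *)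

(* Defs.v *)
From mathcomp Require Import all_boot all_order all_algebra.

Set Implicit Arguments.
Unset Strict Implicit.
Unset Printing Implicit Defensive.

Import GRing.Theory.
Local Open Scope ring_scope.

(* Morphism spaces are [vectType]s, so they are finite dimensional over [k].  *)
Record linCat (k : fieldType) := LinCat {
  obj :> Type;
  hom : obj -> obj -> vectType k;
  idm : forall X, hom X X;
  comp : forall X Y Z, hom Y Z -> hom X Y -> hom X Z;
  comp1m : forall X Y (f : hom X Y), comp (idm Y) f = f;
  compm1 : forall X Y (f : hom X Y), comp f (idm X) = f;
  compA : forall X Y Z T (h : hom Z T) (g : hom Y Z) (f : hom X Y),
    comp h (comp g f) = comp (comp h g) f;
  comp_linearr : forall X Y Z (g : hom Y Z), linear (@comp X Y Z g);
  comp_linearl : forall X Y Z (f : hom X Y),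
    linear (fun g : hom Y Z => comp g f)
}.

Arguments hom {k l} X Y.
Arguments idm {k l} X.
Arguments comp {k l X Y Z} g f.

Declare Scope cat_scope.
Delimit Scope cat_scope with cat.
Local Open Scope cat_scope.

Notation "g \c f" := (comp g f)
  (at level 45, left associativity, format "g  \c  f") : cat_scope.

Record iso (k : fieldType) (C : linCat k) (X Y : C) := Iso {
  fwd : hom X Y;
  bwd : hom Y X;
  bwdK : bwd \c fwd = idm X;
  fwdK : fwd \c bwd = idm Y
}.

Record monCat (k : fieldType) := MonCat {
  monCat_linCat :> linCat k;
  tens : monCat_linCat -> monCat_linCat -> monCat_linCat;
  unitob : monCat_linCat;
  tensm : forall X X' Y Y' : monCat_linCat,
    hom X X' -> hom Y Y' -> hom (tens X Y) (tens X' Y');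
  tensm1 : forall X Y : monCat_linCat,
    tensm (idm X) (idm Y) = idm (tens X Y);
  tensm_comp : forall (X X' X'' Y Y' Y'' : monCat_linCat)
      (f' : hom X' X'') (f : hom X X') (g' : hom Y' Y'') (g : hom Y Y'),
    tensm (f' \c f) (g' \c g) = tensm f' g' \c tensm f g;
  tensm_linearr : forall (X X' Y Y' : monCat_linCat) (f : hom X X'),
    linear (@tensm X X' Y Y' f);
  tensm_linearl : forall (X X' Y Y' : monCat_linCat) (g : hom Y Y'),
    linear (fun f : hom X X' => tensm f g);
  assoc : forall X Y Z : monCat_linCat,
    iso (tens (tens X Y) Z) (tens X (tens Y Z));
  lunit : forall X : monCat_linCat, iso (tens unitob X) X;
  runit : forall X : monCat_linCat, iso (tens X unitob) X;
  assoc_nat : forall (X X' Y Y' Z Z' : monCat_linCat)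
      (f : hom X X') (g : hom Y Y') (h : hom Z Z'),
    fwd (assoc X' Y' Z') \c tensm (tensm f g) h
      = tensm f (tensm g h) \c fwd (assoc X Y Z);
  lunit_nat : forall (X Y : monCat_linCat) (f : hom X Y),
    fwd (lunit Y) \c tensm (idm unitob) f = f \c fwd (lunit X);
  runit_nat : forall (X Y : monCat_linCat) (f : hom X Y),
    fwd (runit Y) \c tensm f (idm unitob) = f \c fwd (runit X);
  pentagon : forall W X Y Z : monCat_linCat,
    fwd (assoc W X (tens Y Z)) \c fwd (assoc (tens W X) Y Z)
      = tensm (idm W) (fwd (assoc X Y Z)) \c fwd (assoc W (tens X Y) Z)
          \c tensm (fwd (assoc W X Y)) (idm Z);
  triangle : forall X Y : monCat_linCat,
    tensm (idm X) (fwd (lunit Y)) \c fwd (assoc X unitob Y)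
      = tensm (fwd (runit X)) (idm Y)
}.

Arguments tens {k m} X Y.
Arguments unitob {k} m.
Arguments tensm {k m X X' Y Y'} f g.
Arguments assoc {k m} X Y Z.
Arguments lunit {k m} X.
Arguments runit {k m} X.

Notation "X \ox Y" := (tens X Y)
  (at level 40, left associativity, format "X  \ox  Y") : cat_scope.
Notation "f \om g" := (tensm f g)
  (at level 40, left associativity, format "f  \om  g") : cat_scope.

Record braidedCat (k : fieldType) := BraidedCat {
  braidedCat_monCat :> monCat k;
  braid : forall X Y : braidedCat_monCat, iso (X \ox Y) (Y \ox X);
  braid_nat : forall (X X' Y Y' : braidedCat_monCat)
      (f : hom X X') (g : hom Y Y'),
    fwd (braid X' Y') \c (f \om g) = (g \om f) \c fwd (braid X Y);
  hexagon1 : forall X Y Z : braidedCat_monCat,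
    fwd (assoc Y Z X) \c fwd (braid X (Y \ox Z)) \c fwd (assoc X Y Z)
      = (idm Y \om fwd (braid X Z)) \c fwd (assoc Y X Z)
          \c (fwd (braid X Y) \om idm Z);
  hexagon2 : forall X Y Z : braidedCat_monCat,
    bwd (assoc Z X Y) \c fwd (braid (X \ox Y) Z) \c bwd (assoc X Y Z)
      = (fwd (braid X Z) \om idm Y) \c bwd (assoc X Z Y)
          \c (idm X \om fwd (braid Y Z))
}.

Section Linear.
Variables (k : fieldType) (C : linCat k).

Definition zero_object (X : C) : Prop := idm X = 0.

Definition direct_sum (S X Y : C) : Prop :=
  exists (i1 : hom X S) (i2 : hom Y S) (p1 : hom S X) (p2 : hom S Y),
    [/\ p1 \c i1 = idm X, p2 \c i2 = idm Y, p2 \c i1 = 0, p1 \c i2 = 0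
      & i1 \c p1 + i2 \c p2 = idm S].

(* A zero object is the direct sum of the empty family. *)
Definition has_direct_sums : Prop :=
  (exists Z : C, zero_object Z) /\
  (forall X Y : C, exists S : C, direct_sum S X Y).

Definition idempotent_complete : Prop :=
  forall (X : C) (e : hom X X), e \c e = e ->
    exists (Y : C) (r : hom X Y) (s : hom Y X),
      r \c s = idm Y /\ s \c r = e.

Definition cauchy_complete : Prop := has_direct_sums /\ idempotent_complete.

Definition direct_summand (X S : C) : Prop := exists Y : C, direct_sum S X Y.

Definition indecomposable (X : C) : Prop :=
  ~ zero_object X /\
  forall Y Z : C, direct_sum X Y Z -> zero_object Y \/ zero_object Z.

End Linear.

Section Monoidal.
Variables (k : fieldType) (C : monCat k).

(* [End(1) = k] as algebras: the structure map [k -> End(1)] is bijective. *)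
Definition scalar_unit : Prop :=
  bijective (fun a : k => a *: idm (unitob C)).

Definition non_negligible (X : C) : Prop :=
  exists Y : C, direct_summand (unitob C) (Y \ox X).

Fixpoint tens_pow (X : C) (n : nat) : C :=
  if n is n'.+1 then tens_pow X n' \ox X else unitob C.

Definition moderate_growth (X : C) : Prop :=
  exists n : nat,
    (\dim {: hom (tens_pow X n) (tens_pow X n)} < n`!)%N.

Definition dual_pair (Y X : C) : Prop :=
  exists (ev : hom (Y \ox X) (unitob C)) (coev : hom (unitob C) (X \ox Y)),
    fwd (runit X) \c (idm X \om ev) \c fwd (assoc X Y X)
        \c (coev \om idm X) \c bwd (lunit X) = idm X
    /\
    fwd (lunit Y) \c (ev \om idm Y) \c bwd (assoc Y X Y)
        \c (idm Y \om coev) \c bwd (runit Y) = idm Y.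

Definition has_left_dual (X : C) : Prop := exists Y : C, dual_pair Y X.

Definition has_right_dual (X : C) : Prop := exists Y : C, dual_pair X Y.

Definition rigid (X : C) : Prop := has_left_dual X /\ has_right_dual X.

End Monoidal.

Arguments cauchy_complete {k} C.
Arguments scalar_unit {k} C.

(* Main.v *)
From HB Require Import structures.
Require Import Defs.
From mathcomp Require Import all_boot all_order all_algebra.
Import Defs.

Set Implicit Arguments.
Unset Strict Implicit.
Unset Printing Implicit Defensive.

Import GRing.Theory.
Local Open Scope ring_scope.
Local Open Scope cat_scope.

(** Let [p \c i = idm] exhibit the unit as a summand of [Y \ox X].  Transported
    along the braiding, it becomes [e : X \ox Y -> 1] and [w : 1 -> X \ox Y]
    with [e \c w = idm].  Precomposing [e] with the braiding or with the inverse
    braiding gives two candidate evaluations [Y \ox X -> 1], hence two zigzag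
    endomorphisms [B+] and [B-] of [X].  Since [X] is indecomposable, [End X]
    is local, and there are two cases.

    If [B+] or [B-] is invertible, twisting the evaluation by its inverse
    makes one zigzag identity hold.  The other zigzag is then an idempotent
    of [Y], and the object splitting it is a left dual of [X]
    ([left_dual_of_zig]).  In a braided category a left dual is also a right
    dual ([dual_pair_sym]).

    If both lie in the radical, then [n! <= dim End (X^n)] for every [n], which
    contradicts moderate growth.  Let [cyc n i] be the braid on [n + 1] strands
    that carries one strand over [i] others to the last place.
    The key point is that the map from families [F_0, .., F_n] of
    endomorphisms of [X^n] to endomorphisms of [X^(n+1)] given by
    [F |-> \sum_i (F_i |> X) \c cyc n i] is injective ([cyc_free]).  Indeed,
    compose the sum with the inverse of [cyc n j] and close up the last strand
    with [w] and [e] (the partial trace [ptr]).  The term [i = j] returns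
    [F_j], because [e \c w = idm]; for [i <> j] the closed strand straightens to
    a braid in which some strand carries [B+] or [B-] ([deepens_ptr_cyc]).  So
    if the sum is zero, then each [F_j] is a combination of the [F_i]
    precomposed with braids carrying one radical decoration.  Iterating, the
    decorations accumulate.  They slide freely along the strands, so
    eventually some strand carries a long word in the radical, and such words
    vanish by finite dimensionality ([radical_word_eq0]).  Thus every [F_j]
    is zero, and dimensions give
    [(n + 1) * dim End (X^n) <= dim End (X^(n+1))].

    Diagrams are handled with a free object [Z] on the left of all strands:
    a morphism [A \ox B -> A' \ox B'] is represented by its whiskerings
    [Z \ox A \ox B -> Z \ox A' \ox B'], and likewise for cups and caps.  Placing
    diagrams side by side then means substituting for [Z] on one side and
    applying [|> A] on the other, both strictly associative, so associators
    occur only in the few lemmas that set up the calculus. *)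

(** * Linear categories *)

Notation "f |> A" := (tensm f (idm A))
  (at level 40, left associativity, format "f  |>  A") : cat_scope.
Notation "Z <| f" := (tensm (idm Z) f)
  (at level 40, left associativity, format "Z  <|  f") : cat_scope.

Section LinearCategory.
Variables (k : fieldType) (C : linCat k).

(** With composites associated to the left, an equation between composites
    cannot rewrite a segment in the middle of a chain.  These variants can. *)
Lemma comp2_eq (W X Y T : C) (g : hom X Y) (f : hom W X) (h : hom W Y) :
  g \c f = h -> forall x : hom Y T, x \c g \c f = x \c h.
Proof. by move=> <- x; rewrite compA. Qed.

Lemma comp3_eq (V W X Y T : C) (g : hom X Y) (f : hom W X) (e : hom V W)
    (h : hom V Y) :
  g \c f \c e = h -> forall x : hom Y T, x \c g \c f \c e = x \c h.
Proof. by move=> <- x; rewrite !compA. Qed.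

Lemma comp2_cancel (X Y T : C) (g : hom X Y) (f : hom Y X) :
  g \c f = idm Y -> forall x : hom Y T, x \c g \c f = x.
Proof. by move=> gf x; rewrite (comp2_eq gf) compm1. Qed.

Lemma fwdI (X Y T : C) (i : iso X Y) (f g : hom T X) :
  fwd i \c f = fwd i \c g -> f = g.
Proof. by move=> /(congr1 (comp (bwd i))); rewrite !compA bwdK !comp1m. Qed.

Lemma comp_fwdI (X Y T : C) (i : iso X Y) (f g : hom Y T) :
  f \c fwd i = g \c fwd i -> f = g.
Proof.
by move=> /(congr1 (fun h => h \c bwd i)); rewrite !(comp2_cancel (fwdK i)).
Qed.

Lemma fwd_comp_bwd (X Y T : C) (i : iso X Y) (f : hom T X) g :
  fwd i \c f = g -> f = bwd i \c g.
Proof. by move=> <-; rewrite compA bwdK comp1m. Qed.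

Definition iso_inv (X Y : C) (i : iso X Y) : iso Y X :=
  Iso (fwdK i) (bwdK i).

Definition iso_comp (X Y Z : C) (j : iso Y Z) (i : iso X Y) : iso X Z.
Proof.
apply: (@Iso _ _ _ _ (fwd j \c fwd i) (bwd i \c bwd j)).
- by rewrite !compA (comp2_cancel (bwdK _)) bwdK.
- by rewrite !compA (comp2_cancel (fwdK _)) fwdK.
Defined.

Lemma bwd_unique (X Y : C) (i j : iso X Y) : fwd i = fwd j -> bwd i = bwd j.
Proof.
by move=> ij; rewrite -[bwd i]compm1 -(fwdK j) -ij compA bwdK comp1m.
Qed.

Section CompositionIsLinear.
Variables X Y Z : C.

HB.instance Definition _ (g : hom Y Z) :=
  GRing.isLinear.Build k (hom X Y) (hom X Z) *:%R (comp g) (comp_linearr g).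

Definition precomp (f : hom X Y) (g : hom Y Z) : hom X Z := g \c f.

HB.instance Definition _ (f : hom X Y) :=
  GRing.isLinear.Build k (hom Y Z) (hom X Z) *:%R (precomp f) (comp_linearl f).

Lemma compDr (g : hom Y Z) (f f' : hom X Y) :
  g \c (f + f') = g \c f + g \c f'.
Proof. exact: raddfD. Qed.

Lemma compDl (f : hom X Y) (g g' : hom Y Z) :
  (g + g') \c f = g \c f + g' \c f.
Proof. exact: (raddfD (precomp f)). Qed.

Lemma compZr a (g : hom Y Z) (f : hom X Y) : g \c (a *: f) = a *: (g \c f).
Proof. exact: linearZ_LR. Qed.

Lemma compZl a (f : hom X Y) (g : hom Y Z) : (a *: g) \c f = a *: (g \c f).
Proof. exact: (linearZ_LR (precomp f)). Qed.

Lemma comp0r (g : hom Y Z) : g \c 0 = 0 :> hom X Z.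
Proof. exact: raddf0. Qed.

Lemma comp0l (f : hom X Y) : 0 \c f = 0 :> hom X Z.
Proof. exact: (raddf0 (precomp f)). Qed.

Lemma comp_sumr (I : Type) (r : seq I) (P : pred I) (g : hom Y Z)
    (F : I -> hom X Y) :
  g \c (\sum_(i <- r | P i) F i) = \sum_(i <- r | P i) (g \c F i).
Proof. exact: raddf_sum. Qed.

Lemma comp_suml (I : Type) (r : seq I) (P : pred I) (f : hom X Y)
    (G : I -> hom Y Z) :
  (\sum_(i <- r | P i) G i) \c f = \sum_(i <- r | P i) (G i \c f).
Proof. exact: (raddf_sum (precomp f)). Qed.

End CompositionIsLinear.

End LinearCategory.

(** * Monoidal coherence *)

Section MonoidalCategory.
Variables (k : fieldType) (C : monCat k).

Lemma whisker_comp (X Y Z A : C) (g : hom Y Z) (f : hom X Y) :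
  (g \c f) |> A = g |> A \c f |> A.
Proof. by rewrite -tensm_comp comp1m. Qed.

Lemma lwhisker_comp (X Y Z A : C) (g : hom Y Z) (f : hom X Y) :
  A <| (g \c f) = A <| g \c A <| f.
Proof. by rewrite -tensm_comp comp1m. Qed.

Lemma whisker_exchange (X X' Y Y' : C) (f : hom X X') (g : hom Y Y') :
  f |> Y' \c X <| g = X' <| g \c f |> Y.
Proof. by rewrite -!tensm_comp !comp1m !compm1. Qed.

Lemma whiskerK (X Y A : C) (f : hom X Y) (g : hom Y X) :
  g \c f = idm X -> g |> A \c f |> A = idm (X \ox A).
Proof. by rewrite -whisker_comp => ->; rewrite tensm1. Qed.

Lemma lwhiskerK (X Y A : C) (f : hom X Y) (g : hom Y X) :
  g \c f = idm X -> A <| g \c A <| f = idm (A \ox X).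
Proof. by rewrite -lwhisker_comp => ->; rewrite tensm1. Qed.

Definition whisker_iso (X Y A : C) (i : iso X Y) : iso (X \ox A) (Y \ox A) :=
  Iso (whiskerK A (bwdK i)) (whiskerK A (fwdK i)).

Definition lwhisker_iso (A X Y : C) (i : iso X Y) : iso (A \ox X) (A \ox Y) :=
  Iso (lwhiskerK A (bwdK i)) (lwhiskerK A (fwdK i)).

Lemma whisker_inj (X Y : C) (f g : hom X Y) :
  f |> unitob C = g |> unitob C -> f = g.
Proof.
by move=> fg; apply: (@comp_fwdI _ _ _ _ _ (runit X)); rewrite -!runit_nat fg.
Qed.

Lemma lwhisker_inj (X Y : C) (f g : hom X Y) :
  unitob C <| f = unitob C <| g -> f = g.
Proof.
by move=> fg; apply: (@comp_fwdI _ _ _ _ _ (lunit X)); rewrite -!lunit_nat fg.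
Qed.

Lemma assoc_bwd_nat (X X' Y Y' Z Z' : C)
    (f : hom X X') (g : hom Y Y') (h : hom Z Z') :
  bwd (assoc X' Y' Z') \c (f \om (g \om h))
    = (f \om g \om h) \c bwd (assoc X Y Z).
Proof.
apply: (@fwdI _ _ _ _ _ (assoc X' Y' Z')).
by rewrite !compA fwdK comp1m assoc_nat (comp2_cancel (fwdK _)).
Qed.

Lemma runit_bwd_nat (X Y : C) (f : hom X Y) :
  bwd (runit Y) \c f = f |> unitob C \c bwd (runit X).
Proof.
apply: (@fwdI _ _ _ _ _ (runit Y)).
by rewrite !compA fwdK comp1m runit_nat (comp2_cancel (fwdK _)).
Qed.

(** Kelly's two consequences of the pentagon and the triangle: tensoring with
    the unit is faithful, and after whiskering with the unit both equations
    are a triangle transported through a pentagon. *)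
Lemma runit_tens (Z A : C) :
  fwd (runit (Z \ox A)) = Z <| fwd (runit A) \c fwd (assoc Z A (unitob C)).
Proof.
apply: whisker_inj; apply: (@fwdI _ _ _ _ _ (assoc Z A (unitob C))).
rewrite -triangle whisker_comp !compA -[in LHS]tensm1 assoc_nat assoc_nat.
by rewrite (comp2_eq (pentagon _ _ _ _)) !compA -triangle lwhisker_comp.
Qed.

Lemma lunit_tens (A B : C) :
  fwd (lunit (A \ox B)) \c fwd (assoc (unitob C) A B) = fwd (lunit A) |> B.
Proof.
apply: lwhisker_inj.
apply: (@comp_fwdI _ _ _ _ _ (assoc (unitob C) (unitob C \ox A) B)).
apply: (@comp_fwdI _ _ _ _ _ (whisker_iso B (assoc (unitob C) (unitob C) A))).
rewrite /= lwhisker_comp (comp3_eq (esym (pentagon _ _ _ _))) compA triangle.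
rewrite -[in LHS]tensm1 -assoc_nat -triangle -assoc_nat whisker_comp.
by rewrite !compA.
Qed.

Lemma runit_tens_bwd (Z A : C) :
  bwd (runit (Z \ox A))
    = bwd (assoc Z A (unitob C)) \c Z <| bwd (runit A).
Proof.
apply: (@fwdI _ _ _ _ _ (runit (Z \ox A))).
rewrite fwdK {1}runit_tens !compA (comp2_cancel (fwdK _)).
by rewrite lwhiskerK // fwdK.
Qed.

Lemma triangle_bwd (Z A : C) :
  fwd (assoc Z (unitob C) A) \c bwd (runit Z) |> A = Z <| bwd (lunit A).
Proof.
apply: (@fwdI _ _ _ _ _ (lwhisker_iso Z (lunit A))) => /=.
by rewrite compA triangle whiskerK ?fwdK // lwhiskerK ?fwdK.
Qed.

End MonoidalCategory.

(** * String diagrams with a free left object *)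

Section StringDiagrams.
Variables (k : fieldType) (C : monCat k).
Implicit Types Z A B X Y : C.

(** The basic pieces of diagrams are locked: they are composites themselves,
    and rewriting with associativity would otherwise take them apart. *)
Fact string_key : unit. Proof. exact: tt. Qed.

Definition box2 A B A' B' (g : hom (A \ox B) (A' \ox B')) Z :
    hom (Z \ox A \ox B) (Z \ox A' \ox B') :=
  locked_with string_key
    (bwd (assoc Z A' B') \c Z <| g \c fwd (assoc Z A B)).

Definition cup A B (w : hom (unitob C) (A \ox B)) Z : hom Z (Z \ox A \ox B) :=
  locked_with string_key (bwd (assoc Z A B) \c Z <| w \c bwd (runit Z)).

Definition cap A B (e : hom (A \ox B) (unitob C)) Z : hom (Z \ox A \ox B) Z :=
  locked_with string_key (fwd (runit Z) \c Z <| e \c fwd (assoc Z A B)).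

Lemma box2E A B A' B' (g : hom (A \ox B) (A' \ox B')) Z :
  box2 g Z = bwd (assoc Z A' B') \c Z <| g \c fwd (assoc Z A B).
Proof. exact: locked_withE. Qed.

Lemma cupE A B (w : hom (unitob C) (A \ox B)) Z :
  cup w Z = bwd (assoc Z A B) \c Z <| w \c bwd (runit Z).
Proof. exact: locked_withE. Qed.

Lemma capE A B (e : hom (A \ox B) (unitob C)) Z :
  cap e Z = fwd (runit Z) \c Z <| e \c fwd (assoc Z A B).
Proof. exact: locked_withE. Qed.

Lemma assoc_nat1 Z Z' A B (f : hom Z Z') :
  fwd (assoc Z' A B) \c f |> A |> B = f |> (A \ox B) \c fwd (assoc Z A B).
Proof. by rewrite assoc_nat tensm1. Qed.

Lemma assoc_bwd_nat1 Z Z' A B (f : hom Z Z') :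
  bwd (assoc Z' A B) \c f |> (A \ox B) = f |> A |> B \c bwd (assoc Z A B).
Proof. by rewrite -[in LHS]tensm1 assoc_bwd_nat. Qed.

Lemma assoc_nat3 Z A B B' (f : hom B B') :
  fwd (assoc Z A B') \c (Z \ox A) <| f = Z <| (A <| f) \c fwd (assoc Z A B).
Proof. by rewrite -[in LHS]tensm1 assoc_nat. Qed.

Lemma assoc_bwd_nat3 Z A B B' (f : hom B B') :
  bwd (assoc Z A B') \c Z <| (A <| f) = (Z \ox A) <| f \c bwd (assoc Z A B).
Proof. by rewrite assoc_bwd_nat tensm1. Qed.

Lemma box2_nat A B A' B' (g : hom (A \ox B) (A' \ox B')) Z Z' (f : hom Z Z') :
  box2 g Z' \c f |> A |> B = f |> A' |> B' \c box2 g Z.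
Proof.
rewrite !box2E !compA -assoc_bwd_nat1 (comp2_eq (assoc_nat1 _ _ _)) !compA.
by rewrite (comp2_eq (whisker_exchange _ _)) !compA.
Qed.

Lemma cup_nat A B (w : hom (unitob C) (A \ox B)) Z Z' (f : hom Z Z') :
  cup w Z' \c f = f |> A |> B \c cup w Z.
Proof.
rewrite !cupE !compA -assoc_bwd_nat1 (comp2_eq (runit_bwd_nat _)) !compA.
by rewrite (comp2_eq (whisker_exchange _ _)) !compA.
Qed.

Lemma cap_nat A B (e : hom (A \ox B) (unitob C)) Z Z' (f : hom Z Z') :
  cap e Z' \c f |> A |> B = f \c cap e Z.
Proof.
rewrite !capE !compA -runit_nat (comp2_eq (assoc_nat1 _ _ _)) !compA.
by rewrite (comp2_eq (whisker_exchange _ _)) !compA.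
Qed.

Lemma box2_comp A B A' B' A'' B'' (g : hom (A' \ox B') (A'' \ox B''))
    (f : hom (A \ox B) (A' \ox B')) Z :
  box2 (g \c f) Z = box2 g Z \c box2 f Z.
Proof.
by rewrite !box2E !compA (comp2_cancel (fwdK _)) lwhisker_comp !compA.
Qed.

Lemma box2_id A B Z : box2 (idm (A \ox B)) Z = idm (Z \ox A \ox B).
Proof. by rewrite !box2E tensm1 compm1 bwdK. Qed.

Lemma box2_cup A B A' B' (g : hom (A \ox B) (A' \ox B')) w Z :
  box2 g Z \c cup w Z = cup (g \c w) Z.
Proof.
by rewrite !box2E !cupE !compA (comp2_cancel (fwdK _)) lwhisker_comp !compA.
Qed.

Lemma cap_box2 A B A' B' (g : hom (A \ox B) (A' \ox B')) e Z :
  cap e Z \c box2 g Z = cap (e \c g) Z.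
Proof.
by rewrite !box2E !capE !compA (comp2_cancel (fwdK _)) lwhisker_comp !compA.
Qed.

Lemma cap_cup A B (e : hom (A \ox B) (unitob C)) w Z :
  e \c w = idm (unitob C) -> cap e Z \c cup w Z = idm Z.
Proof.
move=> ew; rewrite !capE !cupE !compA (comp2_cancel (fwdK _)).
by rewrite (comp2_eq (esym (lwhisker_comp _ _ _))) ew tensm1 compm1 fwdK.
Qed.

Lemma box2_tens A B A' B' (f : hom A A') (g : hom B B') Z :
  box2 (f \om g) Z = (Z <| f) \om g.
Proof. by rewrite !box2E -compA -assoc_nat compA bwdK comp1m. Qed.

Lemma cup_right A B B' (s : hom B B') (w : hom (unitob C) (A \ox B)) Z :
  (Z \ox A) <| s \c cup w Z = cup (A <| s \c w) Z.
Proof. by rewrite -tensm1 -box2_tens box2_cup. Qed.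

Lemma cap_left A A' B (r : hom A A') (e : hom (A' \ox B) (unitob C)) Z :
  cap e Z \c (Z <| r) |> B = cap (e \c r |> B) Z.
Proof. by rewrite -box2_tens cap_box2. Qed.

Lemma cap_right A B B' (s : hom B B') (e : hom (A \ox B') (unitob C)) Z :
  cap e Z \c (Z \ox A) <| s = cap (e \c A <| s) Z.
Proof. by rewrite -tensm1 -box2_tens cap_box2. Qed.

Definition zig X Y (e : hom (Y \ox X) (unitob C))
    (w : hom (unitob C) (X \ox Y)) : hom X X :=
  fwd (runit X) \c X <| e \c fwd (assoc X Y X) \c w |> X \c bwd (lunit X).

Definition zag X Y (e : hom (Y \ox X) (unitob C))
    (w : hom (unitob C) (X \ox Y)) : hom Y Y :=
  fwd (lunit Y) \c e |> Y \c bwd (assoc Y X Y) \c Y <| w \c bwd (runit Y).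

Lemma pentagon_out Z A E B :
  bwd (assoc (Z \ox E) A B) \c bwd (assoc Z E (A \ox B))
      \c Z <| fwd (assoc E A B)
    = bwd (assoc Z E A) |> B \c bwd (assoc Z (E \ox A) B).
Proof.
apply: (@comp_fwdI _ _ _ _ _ (assoc Z (E \ox A) B)).
apply: (@comp_fwdI _ _ _ _ _ (whisker_iso B (assoc Z E A))) => /=.
rewrite (comp3_eq (esym (pentagon _ _ _ _))) !compA (comp2_cancel (bwdK _)).
by rewrite (comp2_cancel (bwdK _)) bwdK whiskerK // bwdK.
Qed.

Lemma pentagon_mid Z A E B :
  Z <| bwd (assoc A E B) \c fwd (assoc Z A (E \ox B))
    = fwd (assoc Z (A \ox E) B) \c fwd (assoc Z A E) |> B
        \c bwd (assoc (Z \ox A) E B).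
Proof.
apply: (@comp_fwdI _ _ _ _ _ (assoc (Z \ox A) E B)).
rewrite (comp2_cancel (bwdK _)).
apply: (@fwdI _ _ _ _ _ (lwhisker_iso Z (assoc A E B))).
by rewrite /= !compA lwhiskerK ?fwdK // comp1m pentagon.
Qed.

(** A family of bent strands over all [Z] is the whiskering of the single
    endomorphism of its case [Z = 1], so identities between zigzags can be
    checked in the calculus and read off afterwards. *)
Lemma cap_cup_zig X Y (e : hom (Y \ox X) (unitob C)) w Z :
  cap e (Z \ox X) \c cup w Z |> X = Z <| zig e w.
Proof.
rewrite !capE !cupE /zig !whisker_comp !lwhisker_comp !compA runit_tens.
rewrite (comp2_eq (assoc_nat3 _ _ _)) !compA.
have H : fwd (assoc Z X (Y \ox X)) \c fwd (assoc (Z \ox X) Y X)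
     \c bwd (assoc Z X Y) |> X
   = Z <| fwd (assoc X Y X) \c fwd (assoc Z (X \ox Y) X).
  by rewrite pentagon (comp2_cancel (whiskerK _ (fwdK _))).
rewrite (comp3_eq H) !compA (comp2_eq (assoc_nat _ _ _)) !compA.
by rewrite (comp2_eq (triangle_bwd _ _)).
Qed.

Lemma cap_cup_zag X Y (e : hom (Y \ox X) (unitob C)) w Z :
  cap e Z |> Y \c cup w (Z \ox Y) = Z <| zag e w.
Proof.
rewrite !capE !cupE /zag !whisker_comp !lwhisker_comp !compA.
rewrite runit_tens_bwd !compA.
rewrite (comp2_eq (esym (assoc_bwd_nat3 _ _ _))) !compA.
have H : fwd (assoc Z Y X) |> Y \c bwd (assoc (Z \ox Y) X Y)
     \c bwd (assoc Z Y (X \ox Y))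
   = bwd (assoc Z (Y \ox X) Y) \c Z <| bwd (assoc Y X Y).
  apply: (@comp_fwdI _ _ _ _ _ (lwhisker_iso Z (assoc Y X Y))) => /=.
  rewrite (comp3_eq (pentagon_out _ _ _ _)) compA whiskerK ?fwdK // comp1m.
  by rewrite (comp2_cancel (lwhiskerK _ (bwdK _))).
rewrite (comp3_eq H) !compA (comp2_eq (esym (assoc_bwd_nat _ _ _))) !compA.
by rewrite -triangle (comp2_cancel (fwdK _)).
Qed.


End StringDiagrams.

(** * The braiding *)

Section Braiding.
Variables (k : fieldType) (C : braidedCat k).
Implicit Types Z A B E X Y : C.

Definition cross Z A B : hom (Z \ox A \ox B) (Z \ox B \ox A) :=
  box2 (fwd (braid A B)) Z.

Lemma cross_nat Z Z' A B (f : hom Z Z') :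
  cross Z' A B \c f |> A |> B = f |> B |> A \c cross Z A B.
Proof. exact: box2_nat. Qed.

(** The hexagon with a free object on the left: crossing [A] and [B] one after
    the other is crossing [A \ox B], up to associators.  All slides below
    follow from naturality of the latter crossing. *)
Lemma cross_hexagon Z A B E :
  cross Z A E |> B \c cross (Z \ox A) B E
    = bwd (assoc (Z \ox E) A B) \c bwd (assoc Z E (A \ox B))
        \c Z <| fwd (braid (A \ox B) E) \c fwd (assoc Z (A \ox B) E)
        \c fwd (assoc Z A B) |> E.
Proof.
have -> : fwd (braid (A \ox B) E)
    = fwd (assoc E A B) \c (fwd (braid A E) |> B \c bwd (assoc A E B)
        \c A <| fwd (braid B E)) \c fwd (assoc A B E).
  rewrite -hexagon2 !compA.
  by rewrite fwdK comp1m (comp2_cancel (bwdK _)).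
rewrite !lwhisker_comp !compA (comp3_eq (esym (pentagon _ _ _ _))) !compA.
rewrite pentagon_out (comp2_eq (assoc_bwd_nat _ _ _)) !compA.
rewrite (comp2_eq (esym (assoc_nat3 _ _ _))) !compA.
rewrite (comp2_eq (pentagon_mid _ _ _ _)) !compA (comp2_cancel (bwdK _)).
by rewrite /cross !box2E !whisker_comp !compA.
Qed.

(** A strand passes a coupon with two inputs and two outputs. *)
Lemma cross_slide_box2 Z A B A' B' E (g : hom (A \ox B) (A' \ox B')) :
  cross Z A' E |> B' \c cross (Z \ox A') B' E \c box2 g Z |> E
    = box2 g (Z \ox E) \c cross Z A E |> B \c cross (Z \ox A) B E.
Proof.
rewrite cross_hexagon -!compA cross_hexagon !box2E !whisker_comp !compA.
rewrite (comp2_cancel (whiskerK _ (fwdK _))).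
rewrite (comp2_eq (assoc_nat _ _ _)) !compA.
rewrite (comp2_eq (esym (lwhisker_comp _ _ _))) braid_nat lwhisker_comp !compA.
by rewrite (comp2_cancel (fwdK _)) (comp2_eq (assoc_bwd_nat3 _ _ _)) !compA.
Qed.

Lemma yang_baxter Z A B E :
  cross Z B E |> A \c cross (Z \ox B) A E \c cross Z A B |> E
    = cross (Z \ox E) A B \c cross Z A E |> B \c cross (Z \ox A) B E.
Proof. exact: cross_slide_box2. Qed.

(** After whiskering with the unit this is the hexagon with two unit strands,
    in which the braiding with [1 \ox 1] is reduced by naturality to the
    braiding with [1] and then cancels. *)
Lemma braid_unit A :
  fwd (runit A) \c fwd (braid (unitob C) A) = fwd (lunit A).
Proof.
apply: whisker_inj.
rewrite whisker_comp; apply: (@comp_fwdI _ _ _ _ _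
  (iso_inv (assoc (unitob C) A (unitob C)))).
apply: (@comp_fwdI _ _ _ _ _ (lwhisker_iso (unitob C) (braid (unitob C) A))).
rewrite /= (comp3_eq (esym (hexagon2 _ _ _))) !compA -triangle.
rewrite (comp2_cancel (fwdK _)) -braid_nat -!lunit_tens !compA.
rewrite !(comp2_cancel (fwdK _)).
by rewrite lunit_nat.
Qed.

Lemma cross_slide_cup Z A B E (w : hom (unitob C) (A \ox B)) :
  cross Z A E |> B \c cross (Z \ox A) B E \c cup w Z |> E = cup w (Z \ox E).
Proof.
rewrite cross_hexagon !cupE !whisker_comp !compA.
rewrite (comp2_cancel (whiskerK _ (fwdK _))).
rewrite (comp2_eq (assoc_nat _ _ _)) !compA.
rewrite (comp2_eq (triangle_bwd _ _)).
have E0 : Z <| fwd (braid (A \ox B) E) \c Z <| (w |> E)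
    = Z <| (E <| w) \c Z <| fwd (braid (unitob C) E).
  by rewrite -!lwhisker_comp braid_nat.
rewrite (comp2_eq E0) !compA.
have E1 : Z <| fwd (braid (unitob C) E) \c Z <| bwd (lunit E)
    = Z <| bwd (runit E).
  rewrite -lwhisker_comp; congr (_ <| _).
  by rewrite (fwd_comp_bwd (braid_unit E)) (comp2_cancel (fwdK _)).
rewrite (comp2_eq E1) (comp2_eq (assoc_bwd_nat3 _ _ _)).
by rewrite runit_tens_bwd !compA.
Qed.

Lemma cross_slide_cap Z A B E (e : hom (A \ox B) (unitob C)) :
  cap e (Z \ox E) \c cross Z A E |> B \c cross (Z \ox A) B E = cap e Z |> E.
Proof.
rewrite -compA cross_hexagon !capE !whisker_comp !compA.
rewrite (comp2_cancel (fwdK _)) runit_tens.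
rewrite (comp2_eq (assoc_nat3 _ _ _)) !compA (comp2_cancel (fwdK _)).
rewrite (comp2_eq (esym (lwhisker_comp _ _ _))) -braid_nat lwhisker_comp !compA.
rewrite -[Z <| _ \c Z <| _]lwhisker_comp braid_unit -triangle.
by rewrite (comp2_eq (assoc_nat _ _ _)) !compA.
Qed.

End Braiding.

(** * The mirror braiding *)

Section Mirror.
Variables (k : fieldType) (C : braidedCat k).

(** The inverse braiding is again a braiding, whose two hexagons are the
    inverses of the original ones in swapped order.  Applied to it, each lemma
    on over-crossings gives the one on under-crossings. *)
Definition mirror_braid (X Y : C) : iso (X \ox Y) (Y \ox X) :=
  iso_inv (braid Y X).

Lemma mirror_braid_nat (X X' Y Y' : C) (f : hom X X') (g : hom Y Y') :
  fwd (mirror_braid X' Y') \c (f \om g) = (g \om f) \c fwd (mirror_braid X Y).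
Proof.
apply: (@fwdI _ _ _ _ _ (braid Y' X')).
by rewrite !compA fwdK comp1m braid_nat (comp2_cancel (fwdK _)).
Qed.

Lemma mirror_hexagon1 (X Y Z : C) :
  fwd (assoc Y Z X) \c fwd (mirror_braid X (Y \ox Z)) \c fwd (assoc X Y Z)
    = (idm Y \om fwd (mirror_braid X Z)) \c fwd (assoc Y X Z)
        \c (fwd (mirror_braid X Y) \om idm Z).
Proof.
pose i := iso_comp (iso_inv (assoc X Y Z))
  (iso_comp (braid (Y \ox Z) X) (iso_inv (assoc Y Z X))).
pose j := iso_comp (whisker_iso Z (braid Y X))
  (iso_comp (iso_inv (assoc Y X Z)) (lwhisker_iso Y (braid Z X))).
by apply: (@bwd_unique _ _ _ _ i j); rewrite /= !compA hexagon2.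
Qed.

Lemma mirror_hexagon2 (X Y Z : C) :
  bwd (assoc Z X Y) \c fwd (mirror_braid (X \ox Y) Z) \c bwd (assoc X Y Z)
    = (fwd (mirror_braid X Z) \om idm Y) \c bwd (assoc X Z Y)
        \c (idm X \om fwd (mirror_braid Y Z)).
Proof.
pose i := iso_comp (assoc X Y Z)
  (iso_comp (braid Z (X \ox Y)) (assoc Z X Y)).
pose j := iso_comp (lwhisker_iso X (braid Z Y))
  (iso_comp (assoc X Z Y) (whisker_iso Y (braid Z X))).
by apply: (@bwd_unique _ _ _ _ i j); rewrite /= !compA hexagon1.
Qed.

Definition mirror : braidedCat k :=
  BraidedCat mirror_braid_nat mirror_hexagon1 mirror_hexagon2.

End Mirror.

Section OverUnder.
Variables (k : fieldType) (C : braidedCat k).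
Implicit Types Z A B E X Y : C.

Definition under Z A B : hom (Z \ox A \ox B) (Z \ox B \ox A) :=
  @cross k (mirror C) Z A B.

Lemma crossK Z A B : under Z B A \c cross Z A B = idm (Z \ox A \ox B).
Proof. by rewrite -box2_comp /= bwdK box2_id. Qed.

Lemma underK Z A B : cross Z B A \c under Z A B = idm (Z \ox A \ox B).
Proof. by rewrite -box2_comp /= fwdK box2_id. Qed.

(** Pulling a strand across a cup trades its crossing with one leg for a
    crossing with the other.  The strand stays in front, but it now passes in
    the opposite direction, so the new crossing is of the inverse kind. *)
Lemma cross_cup Z A B E (w : hom (unitob C) (A \ox B)) :
  cross Z E A |> B \c cup w (Z \ox E) = under (Z \ox A) B E \c cup w Z |> E.
Proof.
rewrite -(@cross_slide_cup _ (mirror C)) !compA.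
by rewrite whiskerK ?comp1m //; apply: underK.
Qed.

Lemma cap_cross Z A B E (e : hom (A \ox B) (unitob C)) :
  cap e (Z \ox E) \c cross Z A E |> B = cap e Z |> E \c under (Z \ox A) E B.
Proof. by rewrite -cross_slide_cap (comp2_cancel (underK _ _ _)). Qed.

End OverUnder.

Section UnderSlides.
Variables (k : fieldType) (C : braidedCat k).
Implicit Types Z A B E X Y : C.

Lemma under_cup Z A B E (w : hom (unitob C) (A \ox B)) :
  under Z E A |> B \c cup w (Z \ox E) = cross (Z \ox A) B E \c cup w Z |> E.
Proof. exact: (@cross_cup k (mirror C)). Qed.

Lemma cap_under Z A B E (e : hom (A \ox B) (unitob C)) :
  cap e (Z \ox E) \c under Z A E |> B = cap e Z |> E \c cross (Z \ox A) E B.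
Proof. exact: (@cap_cross k (mirror C)). Qed.

Lemma under_slide_cup Z A B E (w : hom (unitob C) (A \ox B)) :
  under Z A E |> B \c under (Z \ox A) B E \c cup w Z |> E = cup w (Z \ox E).
Proof. exact: (@cross_slide_cup k (mirror C)). Qed.

Lemma under_yang_baxter Z A B E :
  under Z B E |> A \c under (Z \ox B) A E \c under Z A B |> E
    = under (Z \ox E) A B \c under Z A E |> B \c under (Z \ox A) B E.
Proof. exact: (@yang_baxter k (mirror C)). Qed.

End UnderSlides.

(** * The local algebra of an indecomposable object *)

Section Endomorphisms.
Variables (k : fieldType) (C : linCat k) (X : C).

Definition endo : Type := hom X X.

HB.instance Definition _ := Vector.on endo.
HB.instance Definition _ := GRing.Zmodule_isPzRing.Build endo
  (@compA k C X X X X) (@comp1m k C X X) (@compm1 k C X X)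
  (fun g g' f => compDl f g g') (@compDr k C X X X).

Definition invertible (f : endo) : Prop :=
  exists g : endo, g * f = 1 /\ f * g = 1.

Definition nilpotent_endo (f : endo) : Prop := exists n, f ^+ n = 0.

(** Formulated without ideals: in a local algebra of finite dimension these are
    exactly the elements of the maximal ideal. *)
Definition radical (f : endo) : Prop :=
  forall r : endo, nilpotent_endo (r * f).

Definition connected : Prop :=
  forall e : endo, e * e = e -> e = 0 \/ e = 1.

(** An idempotent and its complement split, and their images decompose [X]. *)
Lemma indecomposable_connected :
  idempotent_complete C -> indecomposable X -> connected.
Proof.
move=> split_idem [_ indecX] e ee.
have [Y [r [s [rs sr]]]] := split_idem X e ee.
have [|Z [r' [s' [rs' sr']]]] := split_idem X (1 - e).
  change ((1 - e) * (1 - e) = 1 - e).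
  by rewrite mulrBr mulr1 mulrBl mul1r ee subrr subr0.
have r's : r' \c s = 0.
  rewrite -(comp1m r') -rs' -(compm1 s) -rs !compA -(compA r') sr'.
  rewrite -(compA (r' \c _)) sr.
  have -> : r' \c (1 - e) \c e = r' \c ((1 - e) * e) by rewrite compA.
  by rewrite mulrBl mul1r ee subrr comp0r comp0l.
have rs'0 : r \c s' = 0.
  rewrite -(comp1m r) -rs -(compm1 s') -rs' !compA -(compA r) sr.
  rewrite -(compA (r \c _)) sr'.
  have -> : r \c e \c (1 - e) = r \c (e * (1 - e)) by rewrite compA.
  by rewrite mulrBr mulr1 ee subrr comp0r comp0l.
have [|Y0|Z0] := indecX Y Z.
- exists s, s', r, r'; split=> //; rewrite sr sr'.
  by change (e + (1 - e) = 1); rewrite addrC subrK.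
- by left; rewrite -sr -(compm1 s) Y0 comp0r comp0l.
- right; apply/esym/eqP; rewrite -subr_eq0 -[1 - e]sr' -(compm1 s') Z0.
  by rewrite comp0r comp0l.
Qed.

(** The powers of an endomorphism are linearly dependent, so the lowest power
    in a dependency is a multiple of the next one. *)
Lemma power_absorbed (f : endo) :
  exists m (g : endo), f * g = g * f /\ f ^+ m = f ^+ m.+1 * g.
Proof.
set d := \dim {: endo}.
pose s := [tuple f ^+ i | i < d.+1].
have : ~~ free s.
  apply/negP => /eqP; rewrite size_tuple => dim_s.
  by have := dimvS (subvf <<s>>); rewrite dim_s -/d ltnn.
rewrite freeNE => /existsP[i si]; exists i.
have -> : f ^+ i = s`_i by rewrite -tnth_nth tnth_mktuple.
rewrite (coord_span (X := in_tuple (drop i.+1 s)) si).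
apply: (big_ind (fun v => exists g : endo, f * g = g * f /\ v = f ^+ i.+1 * g)).
- by exists 0; rewrite !mulr0 mul0r.
- move=> _ _ [g [fg ->]] [g' [fg' ->]]; exists (g + g').
  by rewrite !mulrDr mulrDl fg fg'.
move=> j _; set a := coord _ _ _.
have scr (u v : endo) : (a *: v) * u = a *: (v * u) by exact: compZl.
have scl (u v : endo) : u * (a *: v) = a *: (u * v) by exact: compZr.
exists (a *: f ^+ j); split; first by rewrite scl scr -exprS exprSr.
rewrite scl -exprD nth_drop; congr (_ *: _).
have ltj : (i.+1 + j < d.+1)%N.
  by case: (j) => j' lj /=; move: lj; rewrite size_drop size_tuple ltn_subRL.
by rewrite -[LHS](tnth_nth _ _ (Ordinal ltj)) tnth_mktuple.
Qed.

(** Fitting's lemma.  The powers of [f] from some point on are unchanged by the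
    factor [h = f * g], so a high power of [h] is idempotent: if it is [0],
    those powers of [f] vanish; if it is [1], then [f] has an inverse. *)
Lemma nilpotent_or_invertible (f : endo) :
  connected -> nilpotent_endo f \/ invertible f.
Proof.
move=> conn; have [m [g [fg fm]]] := power_absorbed f.
pose h := f * g.
have fh : GRing.comm f h by rewrite /GRing.comm /h -mulrA -fg.
have fmh n : f ^+ m.+1 * h ^+ n = f ^+ m.+1.
  elim: n => [|n IHn]; first by rewrite mulr1.
  rewrite (exprS h) mulrA; suff -> : f ^+ m.+1 * h = f ^+ m.+1 by [].
  by rewrite /h mulrA -exprSr (exprS f m.+1) -mulrA -fm -exprS.
have hE : h ^+ m.+1 = g ^+ m.+1 * f ^+ m.+1.
  by rewrite /h fg exprMn_comm // /GRing.comm fg.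
have [] := conn (h ^+ m.+1).
- by rewrite {1}hE -mulrA fmh hE.
- by move=> h0; left; exists m.+1; rewrite -(fmh m.+1) h0 mulr0.
move=> h1; right; exists (g * h ^+ m); split.
  by rewrite -mulrA -(commrX m fh) mulrA -fg -exprS.
by rewrite mulrA -exprS.
Qed.

(** If [f] is nilpotent and [r * f] is not, then [r * f] is invertible, so [f]
    has a left inverse [v]; then [1 = v ^+ n * f ^+ n = 0]. *)
Lemma radical_or_invertible (f : endo) :
  connected -> radical f \/ invertible f.
Proof.
move=> conn; have [[n fn]|] := nilpotent_or_invertible f conn; last by right.
left=> r; have [//|[u [ur _]]] := nilpotent_or_invertible (r * f) conn.
suff f0 : (1 : endo) = 0 by exists 1%N; rewrite expr1 -(mulr1 (r * f)) f0 mulr0.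
have : (u * r) * f = 1 by rewrite -mulrA.
move: (u * r) => v vf.
have vfn j : v ^+ j * f ^+ j = 1.
  elim: j => [|j IHj]; first by rewrite mulr1.
  by rewrite exprSr exprS mulrA -(mulrA (v ^+ j)) vf mulr1.
by rewrite -(vfn n) fn mulr0.
Qed.

Fixpoint radical_word (d : nat) (f : endo) : Prop :=
  if d is d'.+1 then
    exists j g : endo, [/\ radical j, radical_word d' g & f = j * g]
  else True.

(** Multiplying on the left by a radical element strictly shrinks the left
    ideal generated by a nonzero element: from [g = r * j * g] one gets
    [g = (r * j) ^+ n * g = 0]. Hence long words in the radical vanish. *)
Lemma radical_word_eq0 d f :
  radical_word d f -> (\dim {: endo} < d)%N -> f = 0.
Proof.
pose ideal (g : endo) := limg (linfun (precomp g : endo -> endo)).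
have idealP g v : reflect (exists r : endo, v = r * g) (v \in ideal g).
  apply: (iffP memv_imgP) => [[r _ ->]|[r ->]]; exists r; rewrite ?memvf //;
  by rewrite lfunE.
suff dim_ideal : radical_word d f -> f <> 0 ->
    (\dim (ideal f) + d <= \dim {: endo})%N.
  move=> wf lt_d; apply/eqP; apply: contraLR lt_d => /eqP f0.
  by rewrite -leqNgt (leq_trans _ (dim_ideal wf f0)) // leq_addl.
elim: d f => [|d IHd] f; first by rewrite addn0 dimvS ?subvf.
move=> [j [g [radj wg ->]]] jg0.
have g0 : g <> 0 by move=> g0; apply: jg0; rewrite g0 mulr0.
apply: leq_trans (IHd g wg g0); rewrite addnS ltn_add2r.
rewrite ltnNge; apply/negP=> le_dim; apply: g0.
have sub : (ideal (j * g) <= ideal g)%VS.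
  by apply/subvP=> _ /idealP[r ->]; apply/idealP; exists (r * j); rewrite mulrA.
have /eqP eq_ideal : ideal (j * g) == ideal g by rewrite eqEdim sub.
have /idealP[r gE] : g \in ideal (j * g).
  by rewrite eq_ideal; apply/idealP; exists 1; rewrite mul1r.
have [n rjn] := radj r.
have gn i : g = (r * j) ^+ i * g.
  by elim: i => [|i IHi]; rewrite ?mul1r // exprSr -mulrA -(mulrA r) -gE.
by rewrite (gn n) rjn mul0r.
Qed.

End Endomorphisms.

(** * Tensoring is linear *)

Section TensorLinear.
Variables (k : fieldType) (C : monCat k).

Section Whisker.
Variables (X X' Y Y' : C).

Definition tensr (g : hom Y Y') (f : hom X X') : hom (X \ox Y) (X' \ox Y') :=
  f \om g.

HB.instance Definition _ (g : hom Y Y') :=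
  GRing.isLinear.Build k (hom X X') (hom (X \ox Y) (X' \ox Y')) *:%R (tensr g)
    (tensm_linearl g).

HB.instance Definition _ (f : hom X X') :=
  GRing.isLinear.Build k (hom Y Y') (hom (X \ox Y) (X' \ox Y')) *:%R
    (tensm f) (tensm_linearr f).

Lemma tensm0l (g : hom Y Y') : (0 : hom X X') \om g = 0.
Proof. exact: (raddf0 (tensr g)). Qed.

Lemma tensm0r (f : hom X X') : f \om (0 : hom Y Y') = 0.
Proof. exact: raddf0. Qed.

End Whisker.

Lemma whisker_sum (I : Type) (r : seq I) (X X' A : C) (F : I -> hom X X') :
  (\sum_(i <- r) F i) |> A = \sum_(i <- r) (F i |> A).
Proof. exact: (raddf_sum (tensr (idm A))). Qed.

Lemma whisker_linear (X X' A : C) : linear (fun f : hom X X' => f |> A).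
Proof. exact: tensm_linearl. Qed.

End TensorLinear.

(** * Partial traces *)

Section PartialTrace.
Variables (k : fieldType) (C : braidedCat k) (X Y : C).
Variables (e : hom (X \ox Y) (unitob C)) (w : hom (unitob C) (X \ox Y)).

Definition ptr Z Z' (f : hom (Z \ox X) (Z' \ox X)) : hom Z Z' :=
  cap e Z' \c f |> Y \c cup w Z.

Lemma ptr_compl Z Z' Z'' (g : hom Z' Z'') (f : hom (Z \ox X) (Z' \ox X)) :
  ptr (g |> X \c f) = g \c ptr f.
Proof. by rewrite /ptr whisker_comp !compA cap_nat. Qed.

Lemma ptr_compr Z Z' Z'' (f : hom (Z' \ox X) (Z'' \ox X)) (g : hom Z Z') :
  ptr (f \c g |> X) = ptr f \c g.
Proof. by rewrite /ptr whisker_comp !compA (comp2_eq (cup_nat _ _)) !compA. Qed.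

Lemma ptr_id Z : e \c w = idm (unitob C) -> ptr (idm (Z \ox X)) = idm Z.
Proof. by move=> ew; rewrite /ptr tensm1 compm1 cap_cup. Qed.

Lemma ptr_sum Z Z' (I : Type) (r : seq I)
    (F : I -> hom (Z \ox X) (Z' \ox X)) :
  ptr (\sum_(i <- r) F i) = \sum_(i <- r) ptr (F i).
Proof. by rewrite /ptr whisker_sum comp_sumr comp_suml. Qed.

Lemma ptr0 Z Z' : ptr (0 : hom (Z \ox X) (Z' \ox X)) = 0.
Proof. by rewrite /ptr tensm0l comp0r comp0l. Qed.

(** Closing one of the two crossed strands leaves a single strand with a kink,
    which pulls out to a zigzag; the sign of the crossing decides which of the
    two evaluations on [Y \ox X] appears. *)
Lemma ptr_cross Z : ptr (cross Z X X) = Z <| zig (e \c bwd (braid X Y)) w.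
Proof.
by rewrite -cap_cup_zig -cap_box2 /ptr -compA cross_cup compA.
Qed.

Lemma ptr_under Z : ptr (under Z X X) = Z <| zig (e \c fwd (braid Y X)) w.
Proof.
by rewrite -cap_cup_zig -cap_box2 /ptr -compA under_cup compA.
Qed.

(** The closed strand crosses the passive one and returns on the same side of
    it, so the passive strand slides out to the right of the closing loop. *)
Lemma ptr_conj Z (g : hom (Z \ox X) (Z \ox X)) :
  ptr (cross Z X X \c g |> X \c under Z X X) = ptr g |> X.
Proof.
rewrite /ptr !whisker_comp !compA cap_cross (comp2_eq (under_cup _ _ _)) !compA.
rewrite (comp2_eq (esym (cross_nat _ _ _))) !compA.
by rewrite (comp2_cancel (crossK _ _ _)).
Qed.

End PartialTrace.

(** * Decorated strands *)

Section TensorPowers.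
Variables (k : fieldType) (C : braidedCat k) (X : C).
Local Notation pow n := (tens_pow X n).

Lemma cross_tens Z Z' A A' B B' (f : hom Z Z') (r : hom A A') (s : hom B B') :
  cross Z' A' B' \c (f \om r \om s) = (f \om s \om r) \c @cross k C Z A B.
Proof.
rewrite /cross !box2E -compA assoc_nat !compA -assoc_bwd_nat.
rewrite (comp2_eq (esym (tensm_comp _ _ _ _))) comp1m braid_nat.
by rewrite -{1}(compm1 f) tensm_comp !compA.
Qed.

Fixpoint cyc n i : hom (pow n.+1) (pow n.+1) :=
  match n, i with
  | n'.+1, i'.+1 => cross (pow n') X X \c cyc n' i' |> X
  | _, _ => idm _
  end.

Fixpoint cyc_inv n i : hom (pow n.+1) (pow n.+1) :=
  match n, i with
  | n'.+1, i'.+1 => cyc_inv n' i' |> X \c under (pow n') X X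
  | _, _ => idm _
  end.

Lemma cyc_invK n i : cyc n i \c cyc_inv n i = idm (pow n.+1).
Proof.
elim: n i => [|n IHn] [|i] /=; rewrite ?comp1m //.
by rewrite compA (comp2_eq (whiskerK X (IHn i))) compm1 underK.
Qed.

(** The last thing that happens on each of the [n] strands is a word in the
    radical of [End X], and these words have total length [d].  Whatever
    precedes them is arbitrary, so that braids moved past the decorations need
    not be recorded. *)
Fixpoint deep n : nat -> hom (pow n) (pow n) -> Prop :=
  match n with
  | 0 => fun d f => d = 0%N
  | n'.+1 => fun d f => exists d1 d2 (f1 : hom (pow n') (pow n'))
        (r : hom X X) (h : hom (pow n'.+1) (pow n'.+1)),
      [/\ (d1 + d2)%N = d, @deep n' d1 f1, @radical_word k C X d2 r
        & f = (f1 \om r) \c h]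
  end.
Arguments deep : clear implicits.

Lemma deep_id n : deep n 0 (idm (pow n)).
Proof.
elim: n => //= n IHn; exists 0%N, 0%N, (idm _), (idm X), (idm _); split=> //.
by rewrite tensm1 comp1m.
Qed.

(** By pigeonhole, at sufficient depth one strand carries a word longer than
    [\dim (End X)]. *)
Lemma deep_eq0 n d f :
  deep n d f -> (n * \dim {: endo X} < d)%N -> f = 0.
Proof.
elim: n d f => [|n IHn] d f; first by move=> /= ->.
move=> [d1 [d2 [f1 [r [h [<- f1d rd ->]]]]]] lt_d.
have [/(IHn _ _ f1d) -> | le1] := ltnP (n * \dim {: endo X}) d1.
  by rewrite tensm0l comp0l.
have [/(radical_word_eq0 rd) -> | le2] := ltnP (\dim {: endo X}) d2.
  by rewrite tensm0r comp0l.
by have := leq_trans lt_d (leq_add le1 le2); rewrite mulSn addnC ltnn.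
Qed.

Definition deepens n a (g : hom (pow n) (pow n)) : Prop :=
  forall d f, deep n d f -> deep n (a + d)%N (g \c f).
Arguments deepens : clear implicits.

Lemma deepens_id n : deepens n 0 (idm (pow n)).
Proof. by move=> d f fd; rewrite comp1m. Qed.

Lemma deepens_comp n a b g h :
  deepens n a g -> deepens n b h -> deepens n (a + b)%N (g \c h).
Proof.
by move=> ga hb d f fd; rewrite -compA -addnA; apply/ga/hb.
Qed.

Lemma deepens_whisker n a g : deepens n a g -> deepens n.+1 a (g |> X).
Proof.
move=> ga d _ [d1 [d2 [f1 [r [h [<- f1d rd ->]]]]]].
exists (a + d1)%N, d2, (g \c f1), r, h; split=> //; first by rewrite addnA.
  exact: ga.
by rewrite compA -tensm_comp comp1m.
Qed.

Lemma deepens_radical n (j : hom X X) :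
  @radical k C X j -> deepens n.+1 1 (pow n <| j).
Proof.
move=> radj d _ [d1 [d2 [f1 [r [h [<- f1d rd ->]]]]]].
exists d1, d2.+1, f1, (j \c r), h; split=> //; first by rewrite addnS.
  by exists j, r.
by rewrite compA -tensm_comp comp1m.
Qed.

(** Crossing two neighbouring strands exchanges their decorations. *)
Lemma deepens_exchange n (c : hom (pow n.+2) (pow n.+2)) :
  (forall (f : hom (pow n) (pow n)) (r s : hom X X),
     c \c (f \om r \om s) = (f \om s \om r) \c c) ->
  deepens n.+2 0 c.
Proof.
move=> c_nat d _ [d1 [d2 [f12 [s [h [<- deep1 sd ->]]]]]].
have [d3 [d4 [f [r [h' [<- fd rd ->]]]]]] := deep1.
exists (d3 + d2)%N, d4, (f \om s), r, (c \c (h' |> X) \c h); split=> //.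
- by rewrite addnAC.
- by exists d3, d2, f, s, (idm _); split=> //; rewrite compm1.
rewrite !compA -c_nat; congr (_ \c h); rewrite -compA; congr (c \c _).
by rewrite -tensm_comp compm1.
Qed.

Lemma deepens_cross n : deepens n.+2 0 (cross (pow n) X X).
Proof. by apply: deepens_exchange => f r s; apply: cross_tens. Qed.

End TensorPowers.

(** * Growth of tensor powers *)

Section InjectivityAndGrowth.
Variables (k : fieldType) (C : braidedCat k) (X : C).
Local Notation pow n := (tens_pow X n).

Lemma deepens_under n : @deepens k C X n.+2 0 (under (pow n) X X).
Proof.
by apply: deepens_exchange => f r s; apply: (@cross_tens k (mirror C)).
Qed.

Lemma deepens_cyc n i : deepens 0 (cyc X n i).
Proof.
elim: n i => [|n IHn] [|i] /=; try exact: deepens_id.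
apply: (@deepens_comp _ _ _ _ 0 0); first exact: deepens_cross.
exact/deepens_whisker/IHn.
Qed.

Lemma deepens_cyc_inv n i : deepens 0 (cyc_inv X n i).
Proof.
elim: n i => [|n IHn] [|i] /=; try exact: deepens_id.
apply: (@deepens_comp _ _ _ _ 0 0); last exact: deepens_under.
exact/deepens_whisker/IHn.
Qed.

Variables (Y : C) (e : hom (X \ox Y) (unitob C)) (w : hom (unitob C) (X \ox Y)).
Hypothesis ew : e \c w = idm (unitob C).
Hypothesis rad_cross : @radical k C X (zig (e \c bwd (braid X Y)) w).
Hypothesis rad_under : @radical k C X (zig (e \c fwd (braid Y X)) w).

(** If [i] and [j] are both positive, the closed strand crosses its neighbour
    in both braids, and [ptr_conj] removes these two crossings.  If one index
    is [0], there is a single crossing with the neighbour, and closing it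
    produces one of the two zigzags. *)
Lemma deepens_ptr_cyc n i j :
  (i <= n)%N -> (j <= n)%N -> i != j ->
  @deepens k C X n 1 (ptr e w (cyc X n i \c cyc_inv X n j)).
Proof.
elim: n i j => [|n IHn] [|i] [|j] //= lei lej nij.
- rewrite comp1m ptr_compl ptr_under.
  apply: (@deepens_comp _ _ _ _ 0 1); first exact: deepens_cyc_inv.
  exact: deepens_radical.
- rewrite compm1 ptr_compr ptr_cross.
  apply: (@deepens_comp _ _ _ _ 1 0); last exact: deepens_cyc.
  exact: deepens_radical.
rewrite compA (comp2_eq (esym (whisker_comp _ _ _))) ptr_conj.
exact/deepens_whisker/IHn.
Qed.

(** Tracing against [cyc_inv n j] gives
    [F j = - \sum_(i | i != j) F i \c ptr (cyc n i \c cyc_inv n j)], and each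
    of these traces increases depth.  So [F j \c f = 0] is proved for all
    [j] at once, by downward induction on the depth [d] of [f], starting at the
    depth [N] where [f] itself vanishes; depth [0] contains the identity. *)
Lemma cyc_free n (F : 'I_n.+1 -> hom (pow n) (pow n)) :
  \sum_i (F i |> X \c cyc X n i) = 0 -> forall i, F i = 0.
Proof.
move=> F0.
pose N := (n * \dim {: endo X}).+1.
suff Fdeep m d i f : (m + d = N)%N -> @deep k C X n d f -> F i \c f = 0.
  move=> i; rewrite -(compm1 (F i)); apply: (Fdeep N 0%N); last exact: deep_id.
  exact: addn0.
elim: m d i f => [|m IHm] d j f mdN fd.
  by rewrite (deep_eq0 fd) ?comp0r // -/N -mdN add0n.
have := congr1 (fun g => ptr e w (g \c cyc_inv X n j)) F0.
rewrite comp0l ptr0 comp_suml ptr_sum (bigD1 j) //= -compA ptr_compl.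
rewrite cyc_invK ptr_id // compm1 => /(congr1 (fun g => g \c f)).
rewrite comp0l compDl comp_suml big1 ?addr0 // => i nij.
rewrite -compA ptr_compl -compA.
apply: (IHm d.+1); first by rewrite addnS -addSn.
by apply: deepens_ptr_cyc => //; rewrite -ltnS.
Qed.

Lemma dim_pow_step n :
  (n.+1 * \dim {: hom (pow n) (pow n)}
     <= \dim {: hom (pow n.+1) (pow n.+1)})%N.
Proof.
pose V := {ffun 'I_n.+1 -> hom (pow n) (pow n)}.
pose phi (F : V) : hom (pow n.+1) (pow n.+1) := \sum_i (F i |> X \c cyc X n i).
have phi_lin : linear phi.
  move=> a F G; rewrite /phi scaler_sumr -big_split; apply: eq_bigr => i _ /=.
  by rewrite !ffunE whisker_linear compDl compZl.
pose L : {linear V -> hom (pow n.+1) (pow n.+1)} :=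
  HB.pack phi (GRing.isLinear.Build k V _ *:%R phi phi_lin).
have kerL : lker (linfun L) = 0%VS.
  apply/eqP; rewrite -subv0; apply/subvP=> F.
  rewrite memv_ker lfunE memv0 => /eqP/cyc_free F0.
  by apply/eqP/ffunP=> i; rewrite F0 ffunE.
have <- : \dim {: V} = (n.+1 * \dim {: hom (pow n) (pow n)})%N.
  by rewrite !dimvf -{2}(card_ord n.+1).
rewrite -(@limg_dim_eq _ _ _ (linfun L)); first exact/dimvS/subvf.
by rewrite kerL capv0.
Qed.

End InjectivityAndGrowth.

(** * Duality *)

Section Duality.
Variables (k : fieldType) (C : monCat k) (X Y : C).
Variables (e : hom (Y \ox X) (unitob C)) (w : hom (unitob C) (X \ox Y)).

Lemma zig_twist (g : hom X X) : zig (e \c Y <| g) w = zig e w \c g.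
Proof.
apply: lwhisker_inj; rewrite lwhisker_comp -!cap_cup_zig -cap_right.
by rewrite -!compA whisker_exchange.
Qed.

Hypothesis zig1 : zig e w = idm X.

(** The evaluation slides through the zigzag on [Y] and leaves the zigzag on
    [X], which is the identity. *)
Lemma cap_zag Z : cap e Z \c (Z <| zag e w) |> X = cap e Z.
Proof.
rewrite -cap_cup_zag whisker_comp compA cap_nat -compA cap_cup_zig zig1.
by rewrite tensm1 compm1.
Qed.

(** The coevaluation of the later zigzag slides past the earlier one, which the
    evaluation then absorbs by [cap_zag]. *)
Lemma zag_idem : zag e w \c zag e w = zag e w.
Proof.
apply: lwhisker_inj; rewrite lwhisker_comp -{1}cap_cup_zag -compA cup_nat.
by rewrite compA -whisker_comp cap_zag cap_cup_zag.
Qed.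

(** The dual is the image of the idempotent [zag e w] on [Y]: restricting [e]
    and [w] to it leaves the first zigzag unchanged, as [e] absorbs the
    idempotent, and turns the second into [r \c (s \c r) \c s], the identity. *)
Lemma left_dual_of_zig : idempotent_complete C -> has_left_dual X.
Proof.
move=> split_idem; have [Y0 [r [s [rs sr]]]] := split_idem Y _ zag_idem.
exists Y0, (e \c s |> X), (X <| r \c w); split.
  rewrite -[LHS]/(zig _ _); apply: lwhisker_inj; set Z := unitob C.
  rewrite -cap_cup_zig -cap_left -cup_right !whisker_comp !compA.
  have sr' : (Z \ox X) <| s |> X \c (Z \ox X) <| r |> X
      = (Z \ox X) <| zag e w |> X by rewrite -whisker_comp -lwhisker_comp sr.
  by rewrite (comp2_eq sr') cap_zag cap_cup_zig zig1.
rewrite -[LHS]/(zag _ _); apply: lwhisker_inj.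
rewrite -cap_cup_zag -cap_left -cup_right whisker_comp compA.
rewrite (comp2_eq (whisker_exchange _ _)) compA whisker_exchange.
rewrite -!compA -cup_nat 2!compA.
rewrite -[_ \c _ \c cup _ _]compA cap_cup_zag -!lwhisker_comp -sr.
by rewrite !compA rs comp1m rs.
Qed.

End Duality.

(** The new evaluation uses the inverse braiding and the new coevaluation the
    braiding, so that the zigzags acquire two kinks of opposite sign; these
    cancel by the Whitney trick. *)
Lemma dual_pair_sym (k : fieldType) (C : braidedCat k) (X Y : C) :
  dual_pair Y X -> dual_pair X Y.
Proof.
move=> [e [w [zig1 zag1]]].
have {}zig1 : zig e w = idm X := zig1; have {}zag1 : zag e w = idm Y := zag1.
exists (e \c bwd (braid Y X)), (fwd (braid X Y) \c w); split.
  rewrite -[LHS]/(zig _ _); apply: lwhisker_inj; set Z := unitob C.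
  rewrite -cap_cup_zig -cap_box2 -box2_cup whisker_comp compA.
  (* A pair of cancelling crossings lets the free strand slide out of the cap,
     so that Yang-Baxter can move the crossing which cancels the one at the
     cup next to it. *)
  rewrite -[cap e (Z \ox Y)](comp2_cancel (whiskerK X (underK Z Y Y))).
  rewrite cap_cross.
  rewrite -[box2 (bwd _) _]/(under (Z \ox Y) X Y).
  rewrite -[box2 (fwd _) _]/(cross Z X Y).
  have H : under (Z \ox Y) Y X \c under Z Y Y |> X \c under (Z \ox Y) X Y
      \c cross Z X Y |> Y = under Z X Y |> Y \c under (Z \ox X) Y Y.
    by rewrite -under_yang_baxter (comp2_cancel (whiskerK Y (crossK _ _ _))).
  rewrite -3!(compA (cap e Z |> Y)) !compA.
  rewrite -4!(compA (cap e Z |> Y)) H -!compA [_ \c (_ \c cup w Z |> Y)]compA.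
  by rewrite under_slide_cup cap_cup_zag zag1.
rewrite -[LHS]/(zag _ _); apply: lwhisker_inj; set Z := unitob C.
rewrite -cap_cup_zag -cap_box2 -box2_cup whisker_comp compA.
rewrite -[box2 (bwd _) _]/(under Z X Y) -[box2 (fwd _) _]/(cross (Z \ox X) X Y).
rewrite -(cross_slide_cup Z X w) !compA.
have H : cross (Z \ox X) X Y \c cross Z X X |> Y \c cross (Z \ox X) Y X
    = cross Z Y X |> X \c cross (Z \ox Y) X X \c cross Z X Y |> X.
  by rewrite yang_baxter.
rewrite (comp3_eq H) !compA (comp2_cancel (whiskerK X (crossK _ _ _))).
rewrite -cap_under.
by rewrite (comp2_cancel (whiskerK X (crossK _ _ _))) cap_cup_zig zig1.
Qed.

Lemma rigid_of_zig (k : fieldType) (C : braidedCat k) (X Y : C)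
    (e : hom (Y \ox X) (unitob C)) (w : hom (unitob C) (X \ox Y)) :
  idempotent_complete C -> @invertible k C X (zig e w) -> rigid X.
Proof.
move=> split_idem [g [_ zg]].
have [|Y0 dualY0] := @left_dual_of_zig k C X Y (e \c Y <| g) w _ split_idem.
  by rewrite zig_twist.
by split; exists Y0 => //; apply: dual_pair_sym.
Qed.

Theorem theorem1p1 (k : fieldType) (C : braidedCat k)
  (hC : cauchy_complete C) (h1 : scalar_unit C)
  (X : C) (hind : indecomposable X) (hneg : non_negligible X)
  (hgrowth : moderate_growth X) :
  rigid X.
Proof.
have [_ split_idem] := hC.
have connX := indecomposable_connected split_idem hind.
have [Y [_ [i [_ [p [_ [pi _ _ _ _]]]]]]] := hneg.
pose e := p \c bwd (braid Y X); pose w := fwd (braid Y X) \c i.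
have ew : e \c w = idm (unitob C).
  by rewrite /e /w compA (comp2_cancel (bwdK _)).
have [rad_cross|] := radical_or_invertible (zig (e \c bwd (braid X Y)) w) connX;
  last exact: rigid_of_zig.
have [rad_under|] := radical_or_invertible (zig (e \c fwd (braid Y X)) w) connX;
  last exact: rigid_of_zig.
have [n] := hgrowth; rewrite ltnNge => /negP[].
elim: n => [|n IHn]; last first.
  apply: leq_trans (dim_pow_step ew rad_cross rad_under n).
  by rewrite factS leq_mul2l IHn.
rewrite fact0 lt0n dimv_eq0; apply/eqP=> unit0.
have id0 : idm (unitob C) = 0.
  by apply/eqP; rewrite -memv0 -unit0 memvf.
have /eqP : 1 = 0 :> k by apply: (bij_inj h1); rewrite id0 !scaler0.
by rewrite oner_eq0.
Qed.
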